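(* Let $SB_3^+$ be the positive singular braid monoid on three strands, let $b_k$ be the number of elements of $SB_3^+$ of length $k$, and let $f^{[3]}(t)=\sum_{k\ge 0} b_k t^k$. Then $$f^{[3]}(t)=\frac{1}{(1-t)(1-3t-t^2+2t^3)}$$ (as formal power series in $t$).
   Context: The monoid $SB_3^+$ is given by the four generators $\sigma_1,\sigma_2,x_1,x_2$ and the relations $$\sigma_2\sigma_1\sigma_2=\sigma_1\sigma_2\sigma_1,\quad x_2\sigma_1\sigma_2=\sigma_1\sigma_2x_1,\quad x_1\sigma_2\sigma_1=\sigma_2\sigma_1x_2,\quad x_1\sigma_1=\sigma_1x_1,\quad x_2\sigma_2=\sigma_2x_2.$$ All relations are between words of equal length, so each element has a well-defined length: the number of letters in any word in the four generators representing it (the identity has length $0$). *)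

(* Defs.v *)
From HB Require Import structures.
From mathcomp Require Import all_boot all_order all_algebra.
From mathcomp Require Import generic_quotient finmap.
From mathcomp Require Import boolp classical_sets functions cardinality.

Set Implicit Arguments.
Unset Strict Implicit.
Unset Printing Implicit Defensive.

Import GRing.Theory.

Inductive sb3_gen := sigma1 | sigma2 | x1 | x2.

Definition bools_of_sb3_gen (g : sb3_gen) : bool * bool :=
  match g with
  | sigma1 => (false, false) | sigma2 => (false, true)
  | x1 => (true, false) | x2 => (true, true)
  end.

Definition sb3_gen_of_bools (p : bool * bool) : sb3_gen :=
  match p with
  | (false, false) => sigma1 | (false, true) => sigma2
  | (true, false) => x1 | (true, true) => x2
  end.

Lemma bools_of_sb3_genK : cancel bools_of_sb3_gen sb3_gen_of_bools.
Proof. by case. Qed.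

HB.instance Definition _ := Finite.copy sb3_gen (can_type bools_of_sb3_genK).

Notation sb3_word := (seq sb3_gen).

Definition sb3_relations : seq (sb3_word * sb3_word) :=
  [:: ([:: sigma2; sigma1; sigma2], [:: sigma1; sigma2; sigma1]);
      ([:: x2; sigma1; sigma2],     [:: sigma1; sigma2; x1]);
      ([:: x1; sigma2; sigma1],     [:: sigma2; sigma1; x2]);
      ([:: x1; sigma1],             [:: sigma1; x1]);
      ([:: x2; sigma2],             [:: sigma2; x2]) ].

Inductive sb3_cong : sb3_word -> sb3_word -> Prop :=
| sb3_cong_rel u v : (u, v) \in sb3_relations -> sb3_cong u v
| sb3_cong_refl u : sb3_cong u u
| sb3_cong_sym u v : sb3_cong u v -> sb3_cong v u
| sb3_cong_trans u v w : sb3_cong u v -> sb3_cong v w -> sb3_cong u w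
| sb3_cong_cat u u' v v' :
    sb3_cong u u' -> sb3_cong v v' -> sb3_cong (u ++ v) (u' ++ v').

Lemma sb3_cong_size u v : sb3_cong u v -> size u = size v.
Proof.
elim=> {u v} // [u v|u v w _ -> _ -> //|u u' v v' _ Hu _ Hv].
  by rewrite !inE => /or4P[|||/orP[]] /eqP[-> ->].
by rewrite !size_cat Hu Hv.
Qed.

Definition sb3_congb : rel sb3_word := fun u v => `[< sb3_cong u v >].

Lemma sb3_congb_refl : reflexive sb3_congb.
Proof. by move=> u; apply/asboolP/sb3_cong_refl. Qed.

Lemma sb3_congb_sym : symmetric sb3_congb.
Proof. by move=> u v; apply/asboolP/asboolP => /sb3_cong_sym. Qed.

Lemma sb3_congb_trans : transitive sb3_congb.
Proof.
move=> v u w /asboolP uv /asboolP vw.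
exact/asboolP/(sb3_cong_trans uv vw).
Qed.

Definition sb3_equiv : equiv_rel sb3_word :=
  EquivRel sb3_congb sb3_congb_refl sb3_congb_sym sb3_congb_trans.

Definition SB3 : Type := {eq_quot sb3_equiv}%qT.
HB.instance Definition _ := Choice.on SB3.

Definition sb3_class (w : sb3_word) : SB3 := (\pi_{eq_quot sb3_equiv} w)%qT.

Definition sb3_repr (a : SB3) : sb3_word := repr (a : {eq_quot sb3_equiv}%qT).

Lemma sb3_reprK a : sb3_class (sb3_repr a) = a.
Proof. exact: reprK. Qed.

Lemma sb3_classP u v : sb3_class u = sb3_class v <-> sb3_cong u v.
Proof.
split=> [/eqmodP/asboolP //|uv].
by apply/eqmodP/asboolP.
Qed.

Lemma sb3_repr_class w : sb3_cong (sb3_repr (sb3_class w)) w.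
Proof. by apply/sb3_classP; rewrite sb3_reprK. Qed.

Definition sb3_mul (a b : SB3) : SB3 := sb3_class (sb3_repr a ++ sb3_repr b).
Definition sb3_one : SB3 := sb3_class [::].

Lemma sb3_class_cat u v :
  sb3_class (u ++ v) = sb3_mul (sb3_class u) (sb3_class v).
Proof.
by apply/sb3_classP/sb3_cong_sym/sb3_cong_cat; apply: sb3_repr_class.
Qed.

Lemma sb3_mulA : associative sb3_mul.
Proof.
move=> a b c; rewrite -[a]sb3_reprK -[b]sb3_reprK -[c]sb3_reprK.
by rewrite -!sb3_class_cat catA.
Qed.

Lemma sb3_mul1 : left_id sb3_one sb3_mul.
Proof. by move=> a; rewrite -[a]sb3_reprK -sb3_class_cat. Qed.

Lemma sb3_mul1r : right_id sb3_one sb3_mul.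
Proof. by move=> a; rewrite -[a]sb3_reprK -sb3_class_cat cats0. Qed.

HB.instance Definition _ := isMonoid.Build SB3 sb3_mulA sb3_mul1 sb3_mul1r.

Definition sb3_length (a : SB3) : nat := size (sb3_repr a).

Lemma sb3_length_class w : sb3_length (sb3_class w) = size w.
Proof. exact/sb3_cong_size/sb3_repr_class. Qed.

Definition sb3_sphere (k : nat) : set SB3 := [set a | sb3_length a = k]%classic.

Lemma finite_sb3_sphere k : finite_set (sb3_sphere k).
Proof.
apply: (@sub_finite_set _ _
  [set sb3_class (tval t) | t in [set: k.-tuple sb3_gen]]%classic).
  move=> a /= /eqP ak; exists (Tuple ak) => //=; exact: sb3_reprK.
exact/finite_image/finite_finset.
Qed.

(* [fset_set] returns its argument as a finite set, here legitimately by
   [finite_sb3_sphere]. *)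
Definition sb3_count (k : nat) : nat := #|` fset_set (sb3_sphere k)|.

Record fps (R : Type) := Fps { fps_coef : nat -> R }.

Section FpsRing.
Local Open Scope ring_scope.
Variable R : comNzRingType.
Implicit Types f g h : fps R.

HB.instance Definition _ := gen_eqMixin (fps R).
HB.instance Definition _ := gen_choiceMixin (fps R).

Lemma fpsP f g : (forall n, fps_coef f n = fps_coef g n) -> f = g.
Proof. by case: f g => f [g] /= fg; congr Fps; apply/funext. Qed.

Definition fps_zero : fps R := Fps (fun=> 0).
Definition fps_opp f : fps R := Fps (fun n => - fps_coef f n).
Definition fps_add f g : fps R := Fps (fun n => fps_coef f n + fps_coef g n).
Definition fps_one : fps R := Fps (fun n => (n == 0%N)%:R).
Definition fps_mul f g : fps R :=
  Fps (fun n => \sum_(i < n.+1) fps_coef f i * fps_coef g (n - i)).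

Lemma fps_addA : associative fps_add.
Proof. by move=> f g h; apply: fpsP => n /=; rewrite addrA. Qed.
Lemma fps_addC : commutative fps_add.
Proof. by move=> f g; apply: fpsP => n /=; rewrite addrC. Qed.
Lemma fps_add0 : left_id fps_zero fps_add.
Proof. by move=> f; apply: fpsP => n /=; rewrite add0r. Qed.
Lemma fps_addN : left_inverse fps_zero fps_opp fps_add.
Proof. by move=> f; apply: fpsP => n /=; rewrite addNr. Qed.

HB.instance Definition _ :=
  GRing.isZmodule.Build (fps R) fps_addA fps_addC fps_add0 fps_addN.

(* Ring axioms are transferred from [{poly R}] through truncations. *)
Definition fps_trunc m f : {poly R} := \poly_(i < m) fps_coef f i.

Lemma coef_fps_trunc m f i : (i < m)%N -> (fps_trunc m f)`_i = fps_coef f i.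
Proof. by move=> im; rewrite coef_poly im. Qed.

Lemma fps_mul_trunc m f g n : (n < m)%N ->
  fps_coef (fps_mul f g) n = (fps_trunc m f * fps_trunc m g)`_n.
Proof.
move=> nm; rewrite coefM; apply: eq_bigr => i _.
rewrite !coef_fps_trunc //; first exact: leq_ltn_trans (leq_subr _ _) nm.
by apply: leq_ltn_trans nm; rewrite -ltnS.
Qed.

Lemma fps_mulC : commutative fps_mul.
Proof.
by move=> f g; apply: fpsP => n; rewrite !(@fps_mul_trunc n.+1) // mulrC.
Qed.

Lemma fps_mulA : associative fps_mul.
Proof.
move=> f g h; apply: fpsP => n; pose T := fps_trunc n.+1.
transitivity ((T f * (T g * T h))`_n).
  rewrite coefM /=; apply: eq_bigr => i _.
  rewrite coef_fps_trunc //; congr (_ * _).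
  by rewrite -fps_mul_trunc // ltnS leq_subr.
rewrite mulrA coefM /=; apply: eq_bigr => i _.
by rewrite coef_fps_trunc ?ltnS ?leq_subr // -fps_mul_trunc.
Qed.

Lemma fps_mul1 : left_id fps_one fps_mul.
Proof.
move=> f; apply: fpsP => n /=.
rewrite big_ord_recl /= mul1r subn0 big1 ?addr0 // => i _.
by rewrite mul0r.
Qed.

Lemma fps_mulDl : left_distributive fps_mul fps_add.
Proof.
move=> f g h; apply: fpsP => n /=; rewrite -big_split /=.
by apply: eq_bigr => i _; rewrite mulrDl.
Qed.

Lemma fps_one_neq0 : fps_one != 0.
Proof.
apply/eqP => /(congr1 (fun f => fps_coef f 0)) /= /eqP.
by rewrite oner_eq0.
Qed.

HB.instance Definition _ := GRing.Zmodule_isComNzRing.Build (fps R)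
  fps_mulA fps_mulC fps_mul1 fps_mulDl fps_one_neq0.

Definition fps_unit : {pred fps R} := fun f => `[< exists g, g * f = 1 >].

(* As usual in [unitRingType]s, a non-unit is its own inverse by convention. *)
Definition fps_inv f : fps R :=
  if pselect (exists g, g * f = 1) is left ex then sval (cid ex) else f.

Lemma fps_mulV : {in fps_unit, left_inverse 1 fps_inv *%R}.
Proof.
move=> f /asboolP ex; rewrite /fps_inv.
by case: pselect => // ex'; case: cid.
Qed.

Lemma fps_unitPl f g : g * f = 1 -> fps_unit f.
Proof. by move=> gf; apply/asboolP; exists g. Qed.

Lemma fps_inv_out : {in [predC fps_unit], fps_inv =1 id}.
Proof.
by move=> f /asboolPn nex; rewrite /fps_inv; case: pselect.
Qed.

HB.instance Definition _ := GRing.ComNzRing_hasMulInverse.Build (fps R)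
  fps_mulV fps_unitPl fps_inv_out.

Definition fpsX : fps R := Fps (fun n => (n == 1%N)%:R).

End FpsRing.

Arguments fpsX {R}.

Definition sb3_genfun : fps int := Fps (fun k => Posz (sb3_count k)).

(* Main.v *)
(* Any two generators [g], [h] other than the pair [x1], [x2] are related by
   exactly one relation [g u = h v], and this presentation satisfies Garside's
   cube condition. Hence the monoid is left cancellative, and an element
   divisible by [g] and [h] is divisible by [g u]; no element is divisible by
   both [x1] and [x2]. Inclusion-exclusion over the sets of generators dividing
   an element then shows that the inverse of the generating function is the sum
   of [(-1)^|A| t^|lcm A|] over the sets [A] of generators with a common
   multiple: [1 - 4t] from the empty set and singletons, [2t^2 + 3t^3] from
   pairs, and [-2t^4] from [{sigma1, sigma2, x1}] and [{sigma1, sigma2, x2}]. *)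

Require Import Defs.
From mathcomp Require Import all_boot all_algebra.
From mathcomp Require Import finmap boolp classical_sets cardinality.
From mathcomp Require Import ring zify.

Set Implicit Arguments.
Unset Strict Implicit.
Unset Printing Implicit Defensive.

Import GRing.Theory.

Local Open Scope ring_scope.

(* [sb3_complement g h] is the word [g\h] such that [g (g\h) = h (h\g)] is the
   least common right multiple of [g] and [h]; [x1] and [x2] have none. *)
Definition sb3_complement (g h : sb3_gen) : option sb3_word :=
  match g, h with
  | sigma1, sigma2 => Some [:: sigma2; sigma1]
  | sigma2, sigma1 => Some [:: sigma1; sigma2]
  | sigma1, x1 => Some [:: x1]
  | x1, sigma1 => Some [:: sigma1]
  | sigma2, x2 => Some [:: x2]
  | x2, sigma2 => Some [:: sigma2]
  | sigma1, x2 => Some [:: sigma2; x1]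
  | x2, sigma1 => Some [:: sigma1; sigma2]
  | sigma2, x1 => Some [:: sigma1; x2]
  | x1, sigma2 => Some [:: sigma2; sigma1]
  | x1, x2 | x2, x1 => None
  | _, _ => Some [::]
  end.

(** * The defining relations as left rewriting rules *)

Local Notation s1 := (sb3_class [:: sigma1]).
Local Notation s2 := (sb3_class [:: sigma2]).
Local Notation y1 := (sb3_class [:: x1]).
Local Notation y2 := (sb3_class [:: x2]).

Lemma sb3_classM u v : sb3_class (u ++ v) = (sb3_class u * sb3_class v)%g.
Proof. exact: sb3_class_cat. Qed.

Lemma sb3_class_cons g u :
  sb3_class (g :: u) = (sb3_class [:: g] * sb3_class u)%g.
Proof. exact: (sb3_classM [:: g]). Qed.

Lemma sb3_lengthM a b :
  sb3_length (a * b)%g = (sb3_length a + sb3_length b)%N.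
Proof. by rewrite [LHS]sb3_length_class size_cat. Qed.

Lemma sb3_relationM u v a :
  (u, v) \in sb3_relations -> (sb3_class u * a = sb3_class v * a)%g.
Proof. by move=> uv; congr (_ * _)%g; apply/sb3_classP/sb3_cong_rel. Qed.

Local Ltac sb3_split := rewrite ?(sb3_class_cons _ (_ :: _)) -?mulgA ?mul1g.

Lemma sb3_braid a : (s2 * (s1 * (s2 * a)) = s1 * (s2 * (s1 * a)))%g.
Proof.
have := @sb3_relationM [:: sigma2; sigma1; sigma2] [:: sigma1; sigma2; sigma1] a.
by sb3_split; apply; rewrite !in_cons eqxx ?orbT.
Qed.

Lemma sb3_slide21 a : (y2 * (s1 * (s2 * a)) = s1 * (s2 * (y1 * a)))%g.
Proof.
have := @sb3_relationM [:: x2; sigma1; sigma2] [:: sigma1; sigma2; x1] a.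
by sb3_split; apply; rewrite !in_cons eqxx ?orbT.
Qed.

Lemma sb3_slide12 a : (y1 * (s2 * (s1 * a)) = s2 * (s1 * (y2 * a)))%g.
Proof.
have := @sb3_relationM [:: x1; sigma2; sigma1] [:: sigma2; sigma1; x2] a.
by sb3_split; apply; rewrite !in_cons eqxx ?orbT.
Qed.

Lemma sb3_comm1 a : (y1 * (s1 * a) = s1 * (y1 * a))%g.
Proof.
have := @sb3_relationM [:: x1; sigma1] [:: sigma1; x1] a.
by sb3_split; apply; rewrite !in_cons eqxx ?orbT.
Qed.

Lemma sb3_comm2 a : (y2 * (s2 * a) = s2 * (y2 * a))%g.
Proof.
have := @sb3_relationM [:: x2; sigma2] [:: sigma2; x2] a.
by sb3_split; apply; rewrite !in_cons eqxx ?orbT.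
Qed.

(** * Least common right multiples and left cancellation *)

Definition sb3_lcm_factor g h (a b : SB3) : Prop :=
  match sb3_complement g h, sb3_complement h g with
  | Some u, Some v =>
    exists c, a = (sb3_class u * c)%g /\ b = (sb3_class v * c)%g
  | _, _ => False
  end.

Lemma sb3_lcm_factor_sym g h a b :
  sb3_lcm_factor g h a b -> sb3_lcm_factor h g b a.
Proof.
rewrite /sb3_lcm_factor.
by do 2![case: sb3_complement => // ?] => -[c []]; exists c.
Qed.

Lemma sb3_lcm_factor_refl g a : sb3_lcm_factor g g a a.
Proof. by case: g; exists a; rewrite mul1g. Qed.

Lemma sb3_lcm_factor_id g a b : sb3_lcm_factor g g a b -> a = b.
Proof. by case: g => -[c [-> ->]]. Qed.

(** Length-bounded form of [sb3_lcmP], serving as its induction hypothesis. *)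
Definition sb3_lcm_upto n := forall g h a b, (sb3_length a < n)%N ->
  (sb3_class [:: g] * a = sb3_class [:: h] * b)%g -> sb3_lcm_factor g h a b.

Lemma sb3_cancel_upto n u a b : sb3_lcm_upto n ->
  (size u + sb3_length a <= n)%N ->
  (sb3_class u * a = sb3_class u * b)%g -> a = b.
Proof.
move=> lcm_n; elim: u a b => [|g u IHu] a b; first by rewrite !mul1g.
rewrite sb3_class_cons -!mulgA => an E; apply: IHu; first exact: ltnW.
by apply/(@sb3_lcm_factor_id g)/lcm_n; rewrite ?sb3_lengthM ?sb3_length_class.
Qed.

Local Ltac lcm_step lcm_n cn dn :=
  match goal with
  | E : (sb3_class [:: ?g] * ?a = sb3_class [:: ?h] * ?b)%g |- _ =>
    let F := fresh "F" in let c := fresh "c" in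
    have F : sb3_lcm_factor g h a b
      by [apply: lcm_n E; move: cn dn;
          rewrite ?sb3_lengthM ?sb3_length_class /=; lia];
    clear E; rewrite /sb3_lcm_factor /= in F;
    first [case: F => c []; sb3_split => ? ?; subst | case: F]
  end.

Local Ltac lcm_witness w :=
  match goal with
  | c : SB3 |- _ => exists (w * c)%g; sb3_split;
    rewrite ?(sb3_braid, sb3_slide21, sb3_slide12, sb3_comm1, sb3_comm2); done
  end.

(* The cube condition: for pairwise distinct [g], [k], [h], the equation
   [(k\g) c = (k\h) d] is solved by iterating [lcm_n], and each solution is a
   multiple of the lcm of the three generators, or there is none. *)
Lemma sb3_lcm_factor_trans n g k h a z b : sb3_lcm_upto n ->
  (sb3_length z <= n)%N ->
  sb3_lcm_factor g k a z -> sb3_lcm_factor k h z b -> sb3_lcm_factor g h a b.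
Proof.
move=> lcm_n zn.
have [<- /sb3_lcm_factor_id-> //|gk] := eqVneq g k.
have [-> + /sb3_lcm_factor_id<- //|kh] := eqVneq k h.
have [->|gh] := eqVneq g h.
  rewrite /sb3_lcm_factor.
  case: (sb3_complement h k) => // v; case: (sb3_complement k h) => // u.
  move=> [c [-> Ez]] [d [Ez' ->]].
  (* Here [z] equals both [u c] and [u d], and its length is at most [n], so bounded cancellation
     applies. *)
  suff -> : c = d by exact: sb3_lcm_factor_refl.
  apply: (@sb3_cancel_upto n u) => //; last by rewrite -Ez.
  by rewrite -sb3_length_class -sb3_lengthM -Ez.
move=> F1 F2.
case: g gk gh F1 => //; case: k kh F2 => //; case: h => // _ F2 _ _ F1.
all: move: F1 F2; rewrite /sb3_lcm_factor /= => // -[c [? Ez]] // [d [Ez' ?]].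
all: subst a b.
all: have := zn; rewrite {1}Ez => cn; have := zn; rewrite {1}Ez' => dn.
all: move: Ez'; rewrite Ez {z zn Ez}; sb3_split => E.
all: do 4?[lcm_step lcm_n cn dn].
(* The lcm of the three generators has length 4 and that of [g] and [h] length 2 or 3, so the
   missing factor has length 2 or 1. *)
all: first [lcm_witness constr:(s1) | lcm_witness constr:(s2)
  | lcm_witness constr:(y1) | lcm_witness constr:(y2)
  | lcm_witness constr:((s1 * s2)%g) | lcm_witness constr:((s2 * s1)%g)].
Qed.

(** Induction on the derivation of the congruence. Transitivity is where the cube condition enters;
    in a concatenation the first factor decides unless it is empty. *)
Lemma sb3_cong_lcm_factor n u v : sb3_lcm_upto n -> sb3_cong u v ->
  (size u <= n.+1)%N ->
  match u, v with
  | g :: u', h :: v' => sb3_lcm_factor g h (sb3_class u') (sb3_class v')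
  | [::], [::] => True
  | _, _ => False
  end.
Proof.
move=> lcm_n; elim=> {u v} [u v uv|u|u v uv IHuv|u v w uv IHuv vw IHvw
  |u u' v v' uu' IHu vv' IHv] un.
- move: uv; rewrite !in_cons in_nil orbF => uv.
  by case/or4P: uv => [|||/orP[]] /eqP[-> ->];
    rewrite /sb3_lcm_factor /=; exists 1%g; rewrite !mulg1.
- by case: u un => // g u _; apply: sb3_lcm_factor_refl.
- move: IHuv; rewrite (sb3_cong_size uv) => /(_ un).
  by case: u v {uv un} => [|g u] [|h v] // /sb3_lcm_factor_sym.
- have vn := un; rewrite (sb3_cong_size uv) in vn.
  move: (IHuv un) (IHvw vn).
  case: u {IHuv uv un} => [|g u]; case: v {IHvw vw} vn => [|k v] //.
  case: w => [|h w] // vn; apply: (sb3_lcm_factor_trans (n := n)) => //.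
  by rewrite sb3_length_class.
- rewrite size_cat in un.
  have {IHu} := IHu (leq_trans (leq_addr _ _) un).
  have {IHv} := IHv (leq_trans (leq_addl _ _) un).
  move/sb3_classP in vv'.
  case: u {uu' un} => [|g u]; case: u' => [|h u'] // _.
  rewrite /= /sb3_lcm_factor; case: sb3_complement => // p.
  case: sb3_complement => // q [c [Eu Eu']].
  by exists (c * sb3_class v)%g; rewrite !sb3_classM Eu Eu' -!mulgA vv'.
Qed.

Lemma sb3_lcmP g h a b :
  (sb3_class [:: g] * a = sb3_class [:: h] * b)%g -> sb3_lcm_factor g h a b.
Proof.
suff lcm_n n : sb3_lcm_upto n by apply: (lcm_n (sb3_length a).+1).
elim: n {g h a b} => [|n IHn] g h a b; first by [].
rewrite ltnS -(sb3_reprK a) -(sb3_reprK b) sb3_length_class => an.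
rewrite -!sb3_classM => /sb3_classP/(sb3_cong_lcm_factor IHn).
by apply.
Qed.

Lemma sb3_mulgI u : injective (fun a : SB3 => sb3_class u * a)%g.
Proof.
move=> a b; apply: (@sb3_cancel_upto (size u + sb3_length a)) => //.
by move=> g h c d _; apply: sb3_lcmP.
Qed.

(** * Left divisibility and inclusion-exclusion *)

Definition sb3_divides (u : sb3_word) (a : SB3) : bool :=
  `[< exists c, a = (sb3_class u * c)%g >].

Lemma sb3_complementC g h u v :
  sb3_complement g h = Some u -> sb3_complement h g = Some v ->
  sb3_class (g :: u) = sb3_class (h :: v).
Proof.
case: g; case: h => // -[<-] [<-]; apply/sb3_classP;
  by [apply: sb3_cong_refl | apply: sb3_cong_rel; rewrite !in_cons eqxx ?orbT
     |apply/sb3_cong_sym/sb3_cong_rel; rewrite !in_cons eqxx ?orbT].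
Qed.

Lemma sb3_divides_lcm g h u a : sb3_complement g h = Some u ->
  sb3_divides (g :: u) a = sb3_divides [:: g] a && sb3_divides [:: h] a.
Proof.
move=> gh; apply/asboolP/andP => [[c ->]|[/asboolP[c ->] /asboolP[d]]].
  split; apply/asboolP.
    by exists (sb3_class u * c)%g; rewrite mulgA -sb3_classM.
  have [v hg] : exists v, sb3_complement h g = Some v.
    by case: g h gh => [] [] //; eexists.
  exists (sb3_class v * c)%g.
  by rewrite mulgA -sb3_classM -(sb3_complementC gh hg).
move/sb3_lcmP; rewrite /sb3_lcm_factor gh.
case: sb3_complement => // v [e [-> _]].
by exists e; rewrite mulgA -sb3_classM.
Qed.

Lemma sb3_divides_x1x2 a : sb3_divides [:: x1] a && sb3_divides [:: x2] a = false.
Proof.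
by apply/negP => /andP[/asboolP[c ->] /asboolP[d /sb3_lcmP]].
Qed.

(** With [D = sigma1 sigma2 sigma1], one has [D x2 = x1 D]. Conversely, [sb3_lcmP] strips the
    letters of [D] one by one from [D c = x1 d] until [x2] is seen to divide [c]. The next lemma
    does the same from [D x1 = x2 D]. *)
Lemma sb3_divides_delta_x2 a : sb3_divides [:: sigma1; sigma2; sigma1; x2] a =
  sb3_divides [:: sigma1; sigma2; sigma1] a && sb3_divides [:: x1] a.
Proof.
apply/asboolP/andP => [[c ->]|[/asboolP[c ->] /asboolP[d]]].
  split; apply/asboolP; first by exists (y2 * c)%g; sb3_split.
  by exists (s1 * (s2 * (s1 * c)))%g; sb3_split; rewrite sb3_comm1 sb3_slide12.
sb3_split => /sb3_lcmP[e []] + _.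
move/sb3_lcmP => [f [+ _]]; sb3_split => /sb3_mulgI ->.
by exists f; sb3_split.
Qed.

Lemma sb3_divides_delta_x1 a : sb3_divides [:: sigma1; sigma2; sigma1; x1] a =
  sb3_divides [:: sigma1; sigma2; sigma1] a && sb3_divides [:: x2] a.
Proof.
apply/asboolP/andP => [[c ->]|[/asboolP[c ->] /asboolP[d]]].
  split; apply/asboolP; first by exists (y1 * c)%g; sb3_split.
  exists (s1 * (s2 * (s1 * c)))%g; sb3_split.
  by rewrite sb3_slide21 sb3_comm1.
sb3_split => /sb3_lcmP[e []] + _; sb3_split => /sb3_mulgI/sb3_lcmP[f [-> _]].
by exists f; sb3_split.
Qed.

Lemma sb3_divides_gen a : (a == 1%g) =
  ~~ [|| sb3_divides [:: sigma1] a, sb3_divides [:: sigma2] a,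
         sb3_divides [:: x1] a | sb3_divides [:: x2] a].
Proof.
have ndiv1 g : sb3_divides [:: g] 1%g = false.
  apply/negP => /asboolP[c] /(congr1 sb3_length).
  by rewrite sb3_lengthM !sb3_length_class.
case: eqVneq => [->|]; first by rewrite !ndiv1.
rewrite -(sb3_reprK a); case: (sb3_repr a) => [/eqP //|g u _].
have : sb3_divides [:: g] (sb3_class (g :: u)).
  by apply/asboolP; exists (sb3_class u); rewrite -sb3_classM.
by case: g => ->; rewrite ?orbT.
Qed.

(** The twelve terms come from the sets of generators not containing both [x1] and [x2]. Once
    divisibility by an lcm is turned into a conjunction, a truth table over the four generators
    suffices. *)
Lemma sb3_mobius (a : SB3) :
  let d u : int := (sb3_divides u a)%:R in
  (a == 1%g)%:R = d [::]
    - d [:: sigma1] - d [:: sigma2] - d [:: x1] - d [:: x2]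
    + d [:: sigma1; x1] + d [:: sigma2; x2]
    + d [:: sigma1; sigma2; x1] + d [:: sigma2; sigma1; x2]
    + d [:: sigma1; sigma2; sigma1]
    - d [:: sigma1; sigma2; sigma1; x2] - d [:: sigma1; sigma2; sigma1; x1].
Proof.
have d1 : sb3_divides [::] a by apply/asboolP; exists a; rewrite mul1g.
move=> d; rewrite /d d1 sb3_divides_gen sb3_divides_delta_x1 sb3_divides_delta_x2.
rewrite (@sb3_divides_lcm sigma1 x1 [:: x1]) //.
rewrite (@sb3_divides_lcm sigma2 x2 [:: x2]) //.
rewrite (@sb3_divides_lcm sigma1 x2 [:: sigma2; x1]) //.
rewrite (@sb3_divides_lcm sigma2 x1 [:: sigma1; x2]) //.
rewrite (@sb3_divides_lcm sigma1 sigma2 [:: sigma2; sigma1]) //.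
move: (sb3_divides_x1x2 a).
by do 4![case: sb3_divides].
Qed.

(** * Counting the multiples of a word by length *)

Lemma mem_sb3_sphere n a :
  (a \in fset_set (sb3_sphere n)) = (sb3_length a == n).
Proof.
rewrite in_fset_set; last exact: finite_sb3_sphere.
by apply/idP/eqP; rewrite inE.
Qed.

(** By left cancellation, multiplication by [u] is a bijection from the elements of length
    [n - size u] onto the multiples of [u] of length [n]. *)
Lemma count_sb3_divides u n :
  count (sb3_divides u) (fset_set (sb3_sphere n)) =
  (if size u <= n then sb3_count (n - size u) else 0)%N.
Proof.
rewrite -size_filter; case: leqP => [un|nu]; last first.
  apply/eqP; rewrite size_filter -leqn0 leqNgt -has_count; apply/hasP => -[a].
  rewrite mem_sb3_sphere => /eqP an /asboolP[c ac].
  by move: nu; rewrite -an ac sb3_lengthM sb3_length_class ltnNge leq_addr.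
rewrite /sb3_count -[RHS](size_map (fun a : SB3 => sb3_class u * a)%g).
apply/perm_size/uniq_perm.
- by rewrite filter_uniq // fset_uniq.
- by rewrite map_inj_uniq ?fset_uniq //; exact: sb3_mulgI.
move=> a; rewrite mem_filter mem_sb3_sphere; apply/andP/mapP.
  move=> [/asboolP[c ->] /eqP an]; exists c => //.
  by rewrite mem_sb3_sphere -an sb3_lengthM sb3_length_class addKn.
move=> [c + ->]; rewrite mem_sb3_sphere => /eqP cn; split.
  by apply/asboolP; exists c.
by rewrite sb3_lengthM sb3_length_class cn subnKC.
Qed.

(** * Coefficients of power series and the final computation *)

Lemma fps_coefD (R : comNzRingType) (f g : fps R) n :
  fps_coef (f + g) n = fps_coef f n + fps_coef g n.
Proof. by []. Qed.

Lemma fps_coefB (R : comNzRingType) (f g : fps R) n :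
  fps_coef (f - g) n = fps_coef f n - fps_coef g n.
Proof. by []. Qed.

Lemma fps_coefXM (R : comNzRingType) (f : fps R) n :
  fps_coef (fpsX * f) n = if n is m.+1 then fps_coef f m else 0.
Proof.
case: n => [|n]; rewrite [LHS]/= big_ord_recl /= mul0r ?big_ord0 ?add0r //.
rewrite big_ord_recl /= mul1r subSS subn0 big1 ?addr0 // => i _.
by rewrite mul0r.
Qed.

Lemma fps_coefXnM (R : comNzRingType) (f : fps R) k n :
  fps_coef (fpsX ^+ k * f) n = if (k <= n)%N then fps_coef f (n - k) else 0.
Proof.
elim: k n => [|k IHk] n; first by rewrite mul1r subn0.
by rewrite exprS -mulrA fps_coefXM; case: n => // n; rewrite IHk.
Qed.

Lemma sum_sb3_divides u n :
  \sum_(a <- fset_set (sb3_sphere n)) (sb3_divides u a)%:R =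
  fps_coef (fpsX ^+ size u * sb3_genfun) n.
Proof.
transitivity (Posz (count (sb3_divides u) (fset_set (sb3_sphere n)))).
  rewrite -sum1_count -natz natr_sum [RHS]big_mkcond.
  by apply: eq_bigr => a _; case: sb3_divides.
by rewrite fps_coefXnM count_sb3_divides; case: ifP.
Qed.

Theorem theorem2p2 :
  let t : fps int := fpsX in
  sb3_genfun = 1 / ((1 - t) * (1 - 3 * t - t ^+ 2 + 2 * t ^+ 3)).
Proof.
move=> t.
suff fP : ((1 - t) * (1 - 3 * t - t ^+ 2 + 2 * t ^+ 3)) * sb3_genfun = 1.
  by rewrite div1r; apply/esym/mulr1_eq.
pose F k := t ^+ k * sb3_genfun.
(* The expansion is kept as twelve terms matching, in order, the words of [sb3_mobius] by length. *)
have -> : (1 - t) * (1 - 3 * t - t ^+ 2 + 2 * t ^+ 3) * sb3_genfun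
    = F 0%N - F 1%N - F 1%N - F 1%N - F 1%N + F 2%N + F 2%N
      + F 3%N + F 3%N + F 3%N - F 4%N - F 4%N by rewrite /F; ring.
apply: fpsP => n; rewrite !(fps_coefB, fps_coefD).
(* Both sides count the identity among the elements of length [n]: 1 if [n] is 0, and 0
   otherwise. *)
transitivity (\sum_(a <- fset_set (sb3_sphere n)) (a == 1%g)%:R : int).
  under [RHS]eq_bigr do rewrite sb3_mobius.
  by rewrite !(big_split, sumrN) !sum_sb3_divides.
transitivity (Posz (count_mem 1%g (fset_set (sb3_sphere n)))).
  rewrite -sum1_count -natz natr_sum [RHS]big_mkcond.
  by apply: eq_bigr => a _ /=; case: eqVneq.
rewrite count_uniq_mem ?fset_uniq // mem_sb3_sphere sb3_length_class eq_sym.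
by case: n.
Qed.
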